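(* $OMCUT_3 = QMET_3$. This cone has exactly $12$ extreme rays, namely those generated by the $12$ non-zero oriented multi-cuts on $V_3$. Under the action of $\mathbb{Z}_2\times Sym(3)$ they form exactly two orbits: the orbit of the $6$ oriented cuts, represented by $\delta'(\{1\},\{2,3\})$, and the orbit of the other $6$ oriented multi-cuts, represented by $\delta'(\{1\},\{2\},\{3\})$. The cone has exactly $12$ facets: the $6$ facets induced by the oriented triangle inequalities $OT_{ij,k}$ and the $6$ facets induced by the non-negativity inequalities $NN_{ij}$. These form exactly two orbits (the $OT$'s and the $NN$'s).
   Context: Let $V_n=\{1,\dots,n\}$. Vectors $d=(d_{ij})_{1\le i\ne j\le n}$ in $\mathbb{R}^{n(n-1)}$ are identified with $n\times n$ matrices with zero diagonal. $QMET_n\subset\mathbb{R}^{n(n-1)}$ is the cone of all $d$ satisfying the oriented triangle inequalities $OT_{ij,k}: d_{ik}+d_{kj}-d_{ij}\ge 0$ (for $i,j,k$ distinct) and the non-negativity inequalities $NN_{ij}: d_{ij}\ge 0$ (for $i\neq j$). For an ordered partition $(S_1,\dots,S_q)$ of $V_n$ into $q\ge 2$ non-empty parts, the oriented multi-cut $\delta'(S_1,\dots,S_q)$ is the vector with $\delta'(S_1,\dots,S_q)_{ij}=1$ if $i\in S_\alpha$, $j\in S_\beta$ with $\alpha<\beta$, and $0$ otherwise. The case $q=2$ is called an oriented cut. $OMCUT_n$ is the convex cone in $\mathbb{R}^{n(n-1)}$ generated by all non-zero oriented multi-cuts on $V_n$. An extreme ray of a cone is a face of dimension $1$; a facet is a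 face of codimension $1$. The group $\mathbb{Z}_2\times Sym(n)$ acts by permuting the points of $V_n$ and by the reversal $d\mapsto d^r$, $d^r_{ij}=d_{ji}$. *)

(* Defs.v *)
From HB Require Import structures.
From mathcomp Require Import all_boot all_order all_algebra all_fingroup.
From mathcomp Require Import boolp classical_sets functions cardinality reals.

Set Implicit Arguments.
Unset Strict Implicit.
Unset Printing Implicit Defensive.

Import Order.TTheory GRing.Theory Num.Theory.

Local Open Scope classical_set_scope.
Local Open Scope ring_scope.

Section Cones.
Variables (R : realType) (V : vectType R).
Implicit Types (C F G : set V) (f : V -> R).

Definition cone_hull G : set V :=
  [set x | exists (k : nat) (g : 'I_k -> V) (c : 'I_k -> R),
     [/\ forall i, G (g i), forall i, 0 <= c i & x = \sum_i c i *: g i]].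

Definition ray (v : V) : set V := [set c *: v | c in [set c : R | 0 <= c]].

Definition valid_on C f := forall x, C x -> 0 <= f x.

Definition induced_face C f : set V := [set x | C x /\ f x = 0].

Definition is_face C F :=
  exists f : {scalar V}, valid_on C f /\ F = induced_face C f.

(* The dimension of the linear span of F; this is also the affine dimension   *)
(* when 0 belongs to F, as is the case for every face of a convex cone.       *)
Definition has_dim F (k : nat) :=
  exists X : k.-tuple V,
    [/\ free X, forall x, x \in X -> F x & forall x, F x -> x \in <<X>>%VS].

Definition extreme_rays C : set (set V) :=
  [set F | is_face C F /\ has_dim F 1].

Definition facets C : set (set V) :=
  [set F | is_face C F /\ exists k : nat, has_dim C k.+1 /\ has_dim F k].

End Cones.

(* R^(n(n-1)) is represented by the n x n matrices with zero diagonal; the    *)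
(* points 1, ..., n are the elements 0, ..., n-1 of 'I_n.                     *)

Definition OT (R : realType) (n : nat) (i j k : 'I_n) (d : 'M[R]_n) : R :=
  d i k + d k j - d i j.

Definition NN (R : realType) (n : nat) (i j : 'I_n) (d : 'M[R]_n) : R := d i j.

Definition QMET (R : realType) (n : nat) : set 'M[R]_n :=
  [set d : 'M[R]_n | [/\ forall i, d i i = 0,
               forall i j k : 'I_n, uniq [:: i; j; k] -> 0 <= OT i j k d
             & forall i j : 'I_n, i != j -> 0 <= NN i j d]].

Definition ordered_partition (n q : nat) (S : q.-tuple {set 'I_n}) : Prop :=
  [/\ (2 <= q)%N, uniq S & finset.partition [set:: S]%SET [set: 'I_n]%SET].

Definition omcut (R : realType) (n q : nat) (S : q.-tuple {set 'I_n}) :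
    'M[R]_n :=
  \matrix_(i, j) [exists a : 'I_q, exists b : 'I_q,
    [&& (a < b)%N, i \in tnth S a & j \in tnth S b]]%:R.

Definition omcuts (R : realType) (n : nat) : set 'M[R]_n :=
  [set d : 'M[R]_n | d <> 0 /\ exists (q : nat) (S : q.-tuple {set 'I_n}),
                       ordered_partition S /\ d = omcut R S].

Definition ocuts (R : realType) (n : nat) : set 'M[R]_n :=
  [set d : 'M[R]_n | d <> 0 /\ exists S : 2.-tuple {set 'I_n},
                       ordered_partition S /\ d = omcut R S].

Definition OMCUT (R : realType) (n : nat) : set 'M[R]_n :=
  cone_hull (@omcuts R n).

Section Symmetry.
Variables (R : realType) (n : nat).
Implicit Types (d : 'M[R]_n) (g : 'Z_2 * 'S_n).

(* Right action: the second component sends the point i to g.2 i, and the     *)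
(* nonzero element of 'Z_2 acts by reversal.                                  *)
Definition act d g : 'M[R]_n :=
  \matrix_(i, j) let i' := (g.2^-1)%g i in let j' := (g.2^-1)%g j in
                 if g.1 == 0 then d i' j' else d j' i'.

Lemma act1 d : act d 1%g = d.
Proof. by apply/matrixP => i j; rewrite mxE /= invg1 !perm1. Qed.

Lemma actM d g h : act d (g * h)%g = act (act d g) h.
Proof.
apply/matrixP => i j; rewrite !mxE /= invMg !permM.
case: g h => [[[|[|//]] ?] s] [[[|[|//]] ?] t] /=.
all: by rewrite ?mxE.
Qed.

Definition act_set (F : set 'M[R]_n) g : set 'M[R]_n := [set act d g | d in F].

Definition orbit_vec d : set 'M[R]_n := [set act d g | g in [set: 'Z_2 * 'S_n]].

Definition orbit_set (F : set 'M[R]_n) : set (set 'M[R]_n) :=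
  [set act_set F g | g in [set: 'Z_2 * 'S_n]].

Definition orbits (X : set (set 'M[R]_n)) : set (set (set 'M[R]_n)) :=
  [set orbit_set F | F in X].

End Symmetry.

Definition OT_faces (R : realType) (n : nat) : set (set 'M[R]_n) :=
  [set F | exists i j k : 'I_n,
     uniq [:: i; j; k] /\ F = induced_face (@QMET R n) (OT i j k)].

Definition NN_faces (R : realType) (n : nat) : set (set 'M[R]_n) :=
  [set F | exists i j : 'I_n,
     i != j /\ F = induced_face (@QMET R n) (NN i j)].

Definition pt1 : 'I_3 := @Ordinal 3 0 isT.
Definition pt2 : 'I_3 := @Ordinal 3 1 isT.
Definition pt3 : 'I_3 := @Ordinal 3 2 isT.

Definition cut_1_23 : 2.-tuple {set 'I_3} :=
  [tuple [set pt1]; [set pt2; pt3]]%SET.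
Definition mcut_1_2_3 : 3.-tuple {set 'I_3} :=
  [tuple [set pt1]; [set pt2]; [set pt3]]%SET.

Arguments QMET : clear implicits.
Arguments OMCUT : clear implicits.
Arguments omcuts : clear implicits.
Arguments ocuts : clear implicits.
Arguments OT_faces : clear implicits.
Arguments NN_faces : clear implicits.

(* Main.v *)
Require Import Defs.
From HB Require Import structures.
From mathcomp Require Import all_boot all_order all_algebra all_fingroup.
From mathcomp Require Import boolp classical_sets functions cardinality reals.
From mathcomp Require Import ring lra zify.

Set Implicit Arguments.
Unset Strict Implicit.
Unset Printing Implicit Defensive.

Import Order.TTheory GRing.Theory Num.Theory.

Local Open Scope classical_set_scope.
Local Open Scope card_scope.
Local Open Scope ring_scope.

(* Reading the entries of a 3-point quasi-metric as u = (d12, d23, d31) and    *)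
(* w = (d21, d32, d13) turns the membership in the cone of multi-cuts into a   *)
(* transportation problem, which is feasible by the triangle inequalities.     *)
(* Hence QMET is generated by the 12 multi-cuts, and every face of dimension 1 *)
(* contains one of them; conversely, the sum of the inequalities tight at a    *)
(* multi-cut exposes its ray. Dually, a face lying in none of the 12 sets      *)
(* cut out by an inequality contains an interior point of the cone, so the     *)
(* facets are among these sets; each of them has a point where no other        *)
(* inequality is tight. Everything is reduced by symmetry to one multi-cut of  *)
(* each kind and to one inequality of each kind.                               *)

(** For the equality of cones, group the six entries along the two directed 3-cycles. If both cycles
    have the same length, the matrix is a combination of the six cuts, obtained from a 3 by 3
    transportation problem with forbidden diagonal ([balanced_transport]). Otherwise, up to
    reversal, the excess is spread over three cyclically rotated linear orders and what remains is
    balanced ([excess_transport]). This yields [OMCUT_QMET].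

    A valid functional that vanishes at a non-negative combination of generators vanishes at every
    generator used, so a face of dimension 1 is the ray of a multi-cut; [ray_gen_face] exposes all
    twelve rays, whence [extreme_raysE]. For facets, [face_sub_ineq_face] places every face other
    than the whole cone inside a face cut out by a single inequality, and equal dimensions turn this
    inclusion into an equality ([facetsE]).

    The group acts transitively on the cuts, on the linear orders and on each family of
    inequalities, so explicit computations are made for one representative of each. All families are
    injectively indexed by finite types built from [bool * 'I_3] and ['S_3], which gives the counts
    and keeps the orbits apart. *)

Lemma card_eq_range (T : finType) (U : Type) (f : T -> U) :
  injective f -> range f #= `I_#|T|.
Proof.
move=> f_inj; apply: card_eq_trans.
  by apply: inj_card_eq => x y _ _; exact: f_inj.
pose h (x : T) := nat_of_ord (enum_rank x).
have -> : `I_#|T| = range h.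
  apply/seteqP; split=> [k /= lt_k|_ [x _ <-]]; last exact: ltn_ord.
  by exists (enum_val (Ordinal lt_k)); rewrite // /h enum_valK.
rewrite card_eq_sym; apply: inj_card_eq => x y _ _ /val_inj.
exact: enum_rank_inj.
Qed.

Lemma card_eq_set2 (T : Type) (x y : T) : x <> y -> [set x; y] #= `I_2.
Proof.
move=> neq_xy; pose f (b : bool) := if b then x else y.
have -> : [set x; y] = range f.
  apply/seteqP; split=> z.
    by case=> ->; [exists true | exists false].
  by case=> -[] _ <-; [left | right].
rewrite -card_bool; apply: card_eq_range => -[] [] //= eq_xy.
by case: neq_xy.
Qed.

Lemma range_sum (A B T : Type) (f : A + B -> T) :
  range f = range (f \o inl) `|` range (f \o inr).
Proof.
apply/seteqP; split=> [_ [[a|b] _ <-]|_ [[a _ <-]|[b _ <-]]].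
- by left; exists a.
- by right; exists b.
- by exists (inl a).
- by exists (inr b).
Qed.

Lemma range_sumD (A B T : Type) (f : A + B -> T) :
  injective f -> range f `\` range (f \o inl) = range (f \o inr).
Proof.
move=> f_inj; apply/seteqP; split=> [x [[[a|b] _ <-]] no_a|_ [b _ <-]].
- by case: no_a; exists a.
- by exists b.
- by split; [exists (inr b) | case=> a _ /f_inj].
Qed.

(** * Ordered partitions as surjective rank functions *)

Section OrderedPartitions.
Variables (R : realType) (n q : nat).
Implicit Types (S : q.-tuple {set 'I_n}) (r : 'I_n -> 'I_q).

Lemma omcut_rank S r (i j : 'I_n) :
  (forall i a, (i \in tnth S a) = (r i == a)) ->
  omcut R S i j = (r i < r j)%:R.
Proof.
move=> rP; rewrite mxE; congr (_%:R); congr (nat_of_bool _).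
apply/existsP/idP => [[a /existsP[b]]|lt_r].
  by rewrite !rP => /and3P[? /eqP-> /eqP->].
by exists (r i); apply/existsP; exists (r j); rewrite !rP !eqxx lt_r.
Qed.

(** Covering and disjointness put each point in exactly one part, and no part is empty. Multi-cuts
    thereby become comparisons of ranks. *)
Lemma ordered_partition_rank S : ordered_partition S ->
  exists r, (forall i a, (i \in tnth S a) = (r i == a)) /\
            (forall a, exists i, r i = a).
Proof.
case=> _ uS /and3P[/eqP covS /finset.trivIsetP trS nS0].
have inS a : tnth S a \in [set:: S]%SET by rewrite inE mem_tnth.
have ex_a i : exists a, i \in tnth S a.
  have : i \in finset.cover [set:: S]%SET by rewrite covS inE.
  case/bigcupP=> B; rewrite inE => /tnthP[a ->] iSa.
  by exists a.
have [r rP] := choice ex_a; exists r.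
have rE i a : (i \in tnth S a) = (r i == a).
  apply/idP/eqP => [iSa|<- //]; apply/eqP; apply: contraT => neq_ra.
  have := trS _ _ (inS (r i)) (inS a).
  rewrite (inj_eq (elimT (tuple_uniqP S) uS)) => /(_ neq_ra).
  by move/pred0P/(_ i); rewrite /= rP iSa.
split=> // a.
have /set0Pn[i iSa] : tnth S a != finset.set0.
  by apply: contra nS0 => /eqP <-.
by exists i; apply/eqP; rewrite -rE.
Qed.

Lemma rank_ordered_partition r : (1 < q)%N -> (forall a, exists i, r i = a) ->
  exists S, ordered_partition S /\
            forall i a, (i \in tnth S a) = (r i == a).
Proof.
move=> lt1q r_surj; pose B a := [set i | r i == a]%SET.
have BP i a : (i \in B a) = (r i == a) by rewrite inE.
exists [tuple B a | a < q]; split; last by move=> i a; rewrite tnth_mktuple BP.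
split=> //.
  rewrite map_inj_uniq ?enum_uniq // => a b eqB.
  have [i ri] := r_surj a.
  by apply/eqP; rewrite -ri -BP -eqB BP ri.
have SP A : A \in [set:: [tuple B a | a < q]]%SET -> exists a, A = B a.
  by rewrite inE => /mapP[a _ ->]; exists a.
have BS a : B a \in [set:: [tuple B a | a < q]]%SET.
  by rewrite inE; apply/mapP; exists a; rewrite ?mem_enum.
apply/and3P; split.
- apply/eqP/setP=> i; rewrite inE; apply/bigcupP.
  by exists (B (r i)); rewrite ?BS ?BP.
- apply/finset.trivIsetP=> A C /SP[a ->] /SP[b ->] neqB.
  apply/pred0P=> i /=; rewrite !BP; apply/negP=> /andP[/eqP ra /eqP rb].
  by case/eqP: neqB; rewrite -ra -rb.
- apply/negP=> /SP[a] /setP eq0; have [i ri] := r_surj a.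
  by have := eq0 i; rewrite BP ri eqxx inE.
Qed.

End OrderedPartitions.

Lemma omcuts_nonzero (R : realType) n q (S : q.-tuple {set 'I_n}) :
  ordered_partition S -> omcut R S <> 0.
Proof.
move=> oS; have [r [rP r_surj]] := ordered_partition_rank oS.
case: oS => lt1q _ _.
have [i ri] := r_surj (Ordinal (ltnW lt1q)); have [j rj] := r_surj (Ordinal lt1q).
move/matrixP/(_ i j)/eqP; rewrite (omcut_rank R i j rP) ri rj mxE /=.
by rewrite oner_eq0.
Qed.

(** * Three points and their permutations *)

Lemma ord3P (P : 'I_3 -> Prop) : P pt1 -> P pt2 -> P pt3 -> forall i, P i.
Proof.
move=> P1 P2 P3 [[|[|[|//]]] lti].
- by rewrite (_ : Ordinal _ = pt1) //; apply: val_inj.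
- by rewrite (_ : Ordinal _ = pt2) //; apply: val_inj.
- by rewrite (_ : Ordinal _ = pt3) //; apply: val_inj.
Qed.

Lemma perm3P (i j k : 'I_3) : uniq [:: i; j; k] ->
  exists s : 'S_3, [/\ s pt1 = i, s pt2 = j & s pt3 = k].
Proof.
move=> u; pose f (x : 'I_3) := nth i [:: i; j; k] x.
have f_inj : injective f.
  by move=> x y /eqP; rewrite nth_uniq //= => /eqP/val_inj.
by exists (perm f_inj); rewrite !permE.
Qed.

Lemma perm2P (i j : 'I_3) : i != j ->
  exists s : 'S_3, s pt1 = i /\ s pt2 = j.
Proof.
move=> neq_ij; have [k /andP[ki kj]] : exists k : 'I_3, (i != k) && (j != k).
  by move: i j neq_ij; do 2 elim/ord3P=> //; move=> _;
    [exists pt3 | exists pt2 | exists pt3 | exists pt1 | exists pt2 | exists pt1].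
have [|s [s1 s2 _]] := @perm3P i j k; first by rewrite /= !inE negb_or neq_ij ki kj.
by exists s.
Qed.

Lemma perm3_eq (s t : 'S_3) : s pt1 = t pt1 -> s pt2 = t pt2 -> s = t.
Proof.
move=> e1 e2; apply/permP; elim/ord3P => //; apply: val_inj.
have neq (u : 'S_3) : [&& u pt1 != u pt2, u pt1 != u pt3 & u pt2 != u pt3].
  by rewrite !(inj_eq perm_inj).
move: (neq s) (neq t); rewrite -e1 -e2 -!val_eqE /=.
move: (ltn_ord (s pt1)) (ltn_ord (s pt2)) (ltn_ord (s pt3)) (ltn_ord (t pt3)).
lia.
Qed.

(** * The twelve multi-cuts on three points *)

Section Generators.
Variable R : realType.

(** Splitting three points in two always isolates one of them. The flag is true when this point
    forms the second part, so that reversal merely flips it. *)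
Definition cut_mx (x : bool * 'I_3) : 'M[R]_3 :=
  \matrix_(i, j) (if x.1 then (i != x.2) && (j == x.2)
                  else (i == x.2) && (j != x.2))%:R.

(** A permutation encodes a linear order by ranks: [s i] is the position of [i], not the point at
    position [i]. *)
Definition mcut_mx (s : 'S_3) : 'M[R]_3 := \matrix_(i, j) (s i < s j)%:R.

Definition gen (x : bool * 'I_3 + 'S_3) : 'M[R]_3 :=
  match x with inl c => cut_mx c | inr s => mcut_mx s end.

Lemma natb_inj (a b : bool) : a%:R = b%:R :> R -> a = b.
Proof. by move=> /eqP; rewrite eqr_nat; case: a b => [] []. Qed.

(** A cut leaves the two points other than [k] unrelated, whereas a linear order relates any two
    distinct points. A linear order is recovered from its matrix because column [i] contains exactly
    [s i] ones. *)
Lemma gen_inj : injective gen.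
Proof.
have cut_not_mcut b k s : cut_mx (b, k) <> mcut_mx s.
  have [i [j [nij ik jk]]] : exists i j, [/\ i != j, i != k & j != k].
    by elim/ord3P: k; [exists pt2, pt3 | exists pt1, pt3 | exists pt1, pt2].
  move=> /matrixP eqM; move: (eqM i j) (eqM j i); rewrite !mxE /=.
  move=> /natb_inj e1 /natb_inj e2; move: e1 e2.
  rewrite (negPf ik) (negPf jk) /= if_same => e1 e2.
  by move: nij; rewrite -(inj_eq (@perm_inj _ s)) neq_ltn -e1 -e2.
case=> [[b k]|s] [[b' k']|s'] /=.
- move=> /matrixP eqM.
  have e i j := natb_inj
    (etrans (esym (mxE _ _ i j)) (etrans (eqM i j) (mxE _ _ i j))).
  move: (e pt1 pt2) (e pt1 pt3) (e pt2 pt1) (e pt2 pt3).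
  clear eqM e; move: b b' k k'.
  by do 2 case; do 2 elim/ord3P.
- by move/cut_not_mcut.
- by move/esym/cut_not_mcut.
- move=> /matrixP eqM; congr inr; apply/permP=> i; apply: val_inj.
  have count_lt (t : 'S_3) : (\sum_j (t j < t i) = t i)%N.
    transitivity (\sum_(j < 3) (j < t i))%N.
      by rewrite [RHS](reindex_inj (@perm_inj _ t)).
    by elim/ord3P: (t i); rewrite !big_ord_recl big_ord0.
  rewrite /= -(count_lt s) -(count_lt s'); apply: eq_bigr => j _.
  by congr nat_of_bool; have := eqM j i; rewrite !mxE => /natb_inj.
Qed.

(** Surjectivity of the ranks bounds [q] by 3. With three parts the rank function is a permutation;
    with two, one part is a singleton. *)
Lemma ordered_partition_gen q (S : q.-tuple {set 'I_3}) : ordered_partition S ->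
  (q = 2 /\ exists c, omcut R S = cut_mx c) \/
  (q = 3 /\ exists s, omcut R S = mcut_mx s).
Proof.
move=> oS; have [r [rP r_surj]] := ordered_partition_rank oS.
have rE i j := omcut_rank R i j rP.
have leq3 : (q <= 3)%N.
  have [g gP] := choice r_surj.
  rewrite -(card_ord q) -(card_ord 3); apply: (leq_card g).
  by apply: can_inj gP.
have lt1q : (1 < q)%N by case: oS.
have [q2|q3] : q = 2 \/ q = 3 by lia.
  subst q; left; split=> //.
  have cutE c : (forall i j, (r i < r j)%N = if c.1 then (i != c.2) && (j == c.2)
                  else (i == c.2) && (j != c.2)) -> exists c, omcut R S = cut_mx c.
    by move=> cP; exists c; apply/matrixP => i j; rewrite rE mxE cP.
  pose l i := r i == ord_max.
  have lE i j : (r i < r j)%N = ~~ l i && l j.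
    by rewrite /l; case: (r i) (r j) => [[|[|//]] ?] [[|[|//]] ?].
  have [i li] := r_surj ord_max; have [j lj] := r_surj ord0.
  have {}li : l i by rewrite /l li.
  have {}lj : ~~ l j by rewrite /l lj.
  suff [c cP] : exists c : bool * 'I_3, forall i j, ~~ l i && l j =
      if c.1 then (i != c.2) && (j == c.2) else (i == c.2) && (j != c.2).
    by apply: (cutE c) => i0 j0; rewrite lE cP.
  have ex (a1 a2 a3 : bool) : l pt1 = a1 -> l pt2 = a2 -> l pt3 = a3 ->
    exists c : bool * 'I_3, forall i j, ~~ l i && l j =
      if c.1 then (i != c.2) && (j == c.2) else (i == c.2) && (j != c.2).
    (* The two constant assignments contradict [li] or [lj]; in the other six, one truth value
       occurs at a single point, which gives the cut. *)
    move=> l1 l2 l3; case: a1 a2 a3 l1 l2 l3 => [] [] [] l1 l2 l3.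
    - by move: j lj; elim/ord3P; rewrite ?l1 ?l2 ?l3.
    - by exists (false, pt3); do 2 elim/ord3P; rewrite ?l1 ?l2 ?l3.
    - by exists (false, pt2); do 2 elim/ord3P; rewrite ?l1 ?l2 ?l3.
    - by exists (true, pt1); do 2 elim/ord3P; rewrite ?l1 ?l2 ?l3.
    - by exists (false, pt1); do 2 elim/ord3P; rewrite ?l1 ?l2 ?l3.
    - by exists (true, pt2); do 2 elim/ord3P; rewrite ?l1 ?l2 ?l3.
    - by exists (true, pt3); do 2 elim/ord3P; rewrite ?l1 ?l2 ?l3.
    - by move: i li; elim/ord3P; rewrite ?l1 ?l2 ?l3.
  exact: (ex _ _ _ erefl erefl erefl).
subst q; right; split=> //.
have r_inj : injective r.
  have [g gP] := choice r_surj.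
  have [h hK gK] : bijective g by apply: injF_bij; apply: can_inj gP.
  by apply: (can_inj (g := g)) => x; rewrite -[x in LHS]gK gP gK.
by exists (perm r_inj); apply/matrixP => i j; rewrite rE mxE !permE.
Qed.

(** The length depends on the constructor so that the lemma serves both [omcutsE] and [ocutsE], the
    latter demanding exactly two parts. *)
Lemma gen_ordered_partition x :
  exists S : (if x is inl _ then 2 else 3).-tuple {set 'I_3},
    ordered_partition S /\ gen x = omcut R S.
Proof.
case: x => [[b k]|s].
  pose r i : 'I_2 := if (i == k) == b then ord_max else ord0.
  have [//|a|S [oS SP]] := rank_ordered_partition (r := r).
    exists (if (a == ord_max) == b then k else if k == pt1 then pt2 else pt1).
    rewrite /r; case: a => [[|[|//]] ?]; move: b k {r} => [] /=; elim/ord3P => /=;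
      exact: val_inj.
  exists S; split=> //; apply/matrixP=> i j; rewrite (omcut_rank R i j SP) mxE.
  by rewrite /r /=; case: b {r SP}; case: (i == k); case: (j == k).
have [//|a|S [oS SP]] := rank_ordered_partition (r := s).
  by exists ((s^-1)%g a); rewrite permKV.
by exists S; split=> //; apply/matrixP=> i j; rewrite (omcut_rank R i j SP) mxE.
Qed.

Lemma omcutsE : omcuts R 3 = range gen.
Proof.
apply/seteqP; split=> [d [_ [q [S [oS ->]]]]|_ [x _ <-]].
  have [[_ [c ->]]|[_ [s ->]]] := ordered_partition_gen oS.
    by exists (inl c).
  by exists (inr s).
have [S [oS ->]] := gen_ordered_partition x.
by split; [exact: omcuts_nonzero | eexists; exists S].
Qed.

Lemma ocutsE : ocuts R 3 = range cut_mx.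
Proof.
apply/seteqP; split=> [d [_ [S [oS ->]]]|_ [c _ <-]].
  by have [[_ [c ->]]|[//]] := ordered_partition_gen oS; exists c.
have [S [oS]] := gen_ordered_partition (inl c) => /= ->.
by split; [exact: omcuts_nonzero | exists S].
Qed.

Lemma gen_nonzero x : gen x <> 0.
Proof.
by have [S [oS ->]] := gen_ordered_partition x; exact: omcuts_nonzero.
Qed.

Lemma omcut_cut_1_23 : omcut R cut_1_23 = cut_mx (false, pt1).
Proof.
apply/matrixP=> i j.
rewrite (@omcut_rank _ _ _ _ (fun i => if i == pt1 then ord0 else ord_max)).
  by rewrite mxE /=; case: (i == pt1) (j == pt1) => [] [].
elim/ord3P=> -[[|[|//]] lt_a]; rewrite (tnth_nth finset.set0) /= !inE //.
Qed.

Lemma omcut_mcut_1_2_3 : omcut R mcut_1_2_3 = mcut_mx 1%g.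
Proof.
apply/matrixP=> i j; rewrite (@omcut_rank _ _ _ _ id) ?mxE ?perm1 //.
by elim/ord3P=> -[[|[|[|//]]] lt_a]; rewrite (tnth_nth finset.set0) /= !inE.
Qed.

End Generators.

(** * Dimension as a property of the linear span *)

Section Dimension.
Variables (R : realType) (V : vectType R).
Implicit Types (F G : set V).

(** The span of a basis taken inside [F] is the least subspace containing [F], hence independent of
    the basis; uniqueness of the dimension follows. *)
Lemma has_dim_span F k : has_dim F k ->
  exists U : {vspace V}, [/\ \dim U = k, forall x, F x -> x \in U
    & forall W : {vspace V}, (forall x, F x -> x \in W) -> (U <= W)%VS].
Proof.
case=> X [freeX XF FX]; exists <<X>>%VS; split=> //.
  by rewrite (eqP freeX) size_tuple.
by move=> W FW; apply/span_subvP => x /XF; exact: FW.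
Qed.

Lemma has_dim_inj F k m : has_dim F k -> has_dim F m -> k = m.
Proof.
case/has_dim_span=> U [<- FU minU] /has_dim_span[W [<- FW minW]].
by congr (\dim _); apply/eqP; rewrite eqEsubv minU ?minW.
Qed.

(** Nested sets of equal dimension have the same span. With [W] the kernel of a functional,
    vanishing on the smaller set implies vanishing on the larger. *)
Lemma has_dim_sub_span F G k : has_dim F k -> has_dim G k -> F `<=` G ->
  forall W : {vspace V}, (forall x, F x -> x \in W) -> forall x, G x -> x \in W.
Proof.
case/has_dim_span=> U [dU FU minU] /has_dim_span[W' [dW GW minW]] FG W FW x Gx.
have eqUW : U = W'.
  by apply/eqP; rewrite eqEdim dU dW leqnn andbT minU // => y /FG/GW.
by apply: (subvP (minU _ FW)); rewrite eqUW GW.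
Qed.

Lemma has_dim_ray (v : V) : v != 0 -> has_dim (ray v) 1.
Proof.
move=> v0; exists [tuple v]; split; first by rewrite seq1_free.
  by move=> x; rewrite inE => /eqP->; exists 1; rewrite /= ?ler01 ?scale1r.
by move=> _ [c _ <-]; rewrite span_seq1 memvZ ?memv_line.
Qed.

Lemma has_dim_image F k (f g : {linear V -> V}) : cancel f g ->
  has_dim F k -> has_dim (f @` F) k.
Proof.
move=> fK [X [freeX XF FX]]; exists [tuple of map f X]; split.
- apply/freeP=> c sum0; apply: (freeP freeX).
  apply: (can_inj fK); rewrite linear0 linear_sum /= -[RHS]sum0.
  by apply: eq_bigr => i _; rewrite linearZ /= -!tnth_nth tnth_map.
- by move=> _ /mapP[x /XF Fx ->]; exists x.
- move=> _ [x /FX xX <-]; have /coord_span -> := xX.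
  rewrite linear_sum rpred_sum // => i _; rewrite linearZ rpredZ //= memv_span //.
  by apply/mapP; exists X`_i; rewrite // mem_nth // size_tuple.
Qed.

End Dimension.

(** * The group acts linearly and permutes the faces *)

Section Action.
Variables (R : realType) (n : nat).
Implicit Types (d : 'M[R]_n) (g : 'Z_2 * 'S_n).

(** Putting the group element first gives a function of the matrix, to which a linear structure can
    be attached. *)
Definition act_by g d := Defs.act d g.

Lemma act_by_linear g : linear (act_by g).
Proof.
move=> c d e; apply/matrixP=> i j; rewrite !mxE /=.
by case: ifP => _; rewrite ?mxE.
Qed.

HB.instance Definition _ g :=
  GRing.isLinear.Build R 'M[R]_n 'M[R]_n *:%R (act_by g) (act_by_linear g).

Lemma act_byK g : cancel (act_by g) (act_by (g^-1)%g).
Proof. by move=> d; rewrite /act_by -Defs.actM mulgV Defs.act1. Qed.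

Lemma act_byKV g : cancel (act_by (g^-1)%g) (act_by g).
Proof. by move=> d; rewrite /act_by -Defs.actM mulVg Defs.act1. Qed.

Lemma act_entry d g i j :
  Defs.act d g (g.2 i) (g.2 j) = if g.1 == 0 then d i j else d j i.
Proof. by rewrite mxE !permK. Qed.

Lemma OT_linear i j k : scalar (@OT R n i j k).
Proof. by move=> c d e; rewrite /OT !mxE; ring. Qed.

HB.instance Definition _ i j k :=
  GRing.isLinear.Build R 'M[R]_n R *%R (OT i j k) (OT_linear i j k).

Lemma NN_linear i j : scalar (@NN R n i j).
Proof. by move=> c d e; rewrite /NN !mxE. Qed.

HB.instance Definition _ i j :=
  GRing.isLinear.Build R 'M[R]_n R *%R (NN i j) (NN_linear i j).

Lemma QMET_act d g : QMET R n d -> QMET R n (Defs.act d g).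
Proof.
case=> d0 dOT dNN; set t := (g.2^-1)%g.
split=> [i|i j k u|i j neq_ij].
- by rewrite mxE /= !d0 if_same.
- have ut : uniq [:: t i; t j; t k] by rewrite (map_inj_uniq perm_inj [:: i; j; k]).
  have ut' : uniq [:: t j; t i; t k].
    by rewrite -(perm_uniq (s1 := [:: t i; t j; t k])) // (perm_catCA [:: _] [:: _]).
  rewrite /OT !mxE /= -/t; case: ifP => _; first exact: (dOT _ _ _ ut).
  by rewrite [X in X - _]addrC; exact: (dOT _ _ _ ut').
- by rewrite /NN mxE /= -/t; case: ifP => _; apply: dNN;
    rewrite (inj_eq perm_inj) // eq_sym.
Qed.

Lemma act_set_ray d g : act_set (ray d) g = ray (Defs.act d g).
Proof.
apply/seteqP; split=> [_ [_ [c c0 <-] <-]|_ [c c0 <-]].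
  by exists c => //; rewrite -[RHS]/(act_by g _) linearZ.
by exists (c *: d); [exists c | rewrite -[LHS]/(act_by g _) linearZ].
Qed.

Lemma is_face_act (F : set 'M[R]_n) g :
  is_face (QMET R n) F -> is_face (QMET R n) (act_set F g).
Proof.
case=> f [f_ge0 ->]; exists (f \o act_by (g^-1)%g); split.
  by move=> x /(QMET_act (g^-1)%g); exact: f_ge0.
apply/seteqP; split=> [_ [x [Cx fx0] <-]|x [Cx fx0]].
  split; first exact: QMET_act.
  by rewrite /= -[Defs.act x g]/(act_by g x) act_byK.
exists (Defs.act x (g^-1)%g); last exact: act_byKV.
by split; [exact: QMET_act | exact: fx0].
Qed.

Lemma act_setM (F : set 'M[R]_n) g h :
  act_set F (g * h)%g = act_set (act_set F g) h.
Proof.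
apply/seteqP; split=> [_ [x Fx <-]|_ [_ [x Fx <-] <-]].
  by rewrite Defs.actM; exists (Defs.act x g) => //; exists x.
by exists x; rewrite ?Defs.actM.
Qed.

Lemma orbit_set_act (F : set 'M[R]_n) g : orbit_set (act_set F g) = orbit_set F.
Proof.
apply/seteqP; split=> [_ [h _ <-]|_ [h _ <-]].
  by exists (g * h)%g; rewrite ?act_setM.
by exists (g^-1 * h)%g => //; rewrite -act_setM mulKVg.
Qed.

Lemma orbit_set_ray d : orbit_set (ray d) = [set ray e | e in orbit_vec d].
Proof.
apply/seteqP; split=> [_ [g _ <-]|_ [_ [g _ <-] <-]].
  by rewrite act_set_ray; exists (Defs.act d g) => //; exists g.
by exists g; rewrite ?act_set_ray.
Qed.

End Action.

(** * Orbits of multi-cuts and of inequalities *)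

Section Orbits.
Variable R : realType.

Lemma act_cut_mx (c : bool * 'I_3) (g : 'Z_2 * 'S_3) :
  Defs.act (cut_mx R c) g = cut_mx R (c.1 (+) (g.1 != 0), g.2 c.2).
Proof.
apply/matrixP=> i j; rewrite -(permKV g.2 i) -(permKV g.2 j) act_entry !mxE /=.
rewrite !(inj_eq perm_inj); case: (g.1 == 0) c.1 => [] [] //=; by rewrite andbC.
Qed.

Definition rev3 : 'S_3 := perm (@rev_ord_inj 3).

(** Reversal exchanges the sides of [s i < s j], which amounts to composing the ranks with the
    order-reversing [rev3]. *)
Lemma act_mcut_mx (s : 'S_3) (g : 'Z_2 * 'S_3) :
  Defs.act (mcut_mx R s) g =
  mcut_mx R (g.2^-1 * s * (if g.1 == 0 then 1 else rev3))%g.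
Proof.
apply/matrixP=> i j; rewrite -(permKV g.2 i) -(permKV g.2 j) act_entry !mxE.
rewrite !permM !permK.
case: ifP => _; rewrite ?perm1 // !permE /=; congr (nat_of_bool _)%:R.
by rewrite ltn_sub2lE // ltnS.
Qed.

Lemma orbit_cut_mx : orbit_vec (cut_mx R (false, pt1)) = range (cut_mx R).
Proof.
apply/seteqP; split=> [_ [g _ <-]|_ [[b k] _ <-]].
  by rewrite act_cut_mx; eexists.
exists (if b then 1 else 0, tperm pt1 k) => //; rewrite act_cut_mx /= tpermL.
by case: b.
Qed.

Lemma orbit_mcut_mx : orbit_vec (mcut_mx R 1) = range (mcut_mx R).
Proof.
apply/seteqP; split=> [_ [g _ <-]|_ [s _ <-]]; first by rewrite act_mcut_mx; eexists.
by exists (0, s^-1)%g => //; rewrite act_mcut_mx /= invgK !mulg1.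
Qed.

(* Two distinct points determine the third one, so both families are indexed   *)
(* bijectively by the permutations.                                            *)
Definition ineq (j : 'S_3 + 'S_3) : {scalar 'M[R]_3} :=
  match j with
  | inl s => OT (s pt1) (s pt2) (s pt3)
  | inr s => NN (s pt1) (s pt2)
  end.

Definition ineq_face j := induced_face (QMET R 3) (ineq j).

Lemma QMET_ineq d : QMET R 3 d <->
  (forall i, d i i = 0) /\ (forall j, 0 <= ineq j d).
Proof.
split=> [[d0 dOT dNN]|[d0 dj]]; split=> //.
- case=> s /=; first (apply: dOT).
    by rewrite (map_inj_uniq perm_inj [:: pt1; pt2; pt3]).
  by apply: dNN; rewrite (inj_eq perm_inj).
- by move=> i j k /perm3P[s [<- <- <-]]; exact: (dj (inl s)).
- by move=> i j /perm2P[s [<- <-]]; exact: (dj (inr s)).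
Qed.

(** Reversal exchanges the endpoints [i] and [j] of an inequality and fixes the middle point [k];
    hence the transposition applied before [s], while relabelling applies after it. *)
Definition ineq_act (g : 'Z_2 * 'S_3) (j : 'S_3 + 'S_3) : 'S_3 + 'S_3 :=
  let h s := ((if g.1 == 0 then 1 else tperm pt1 pt2) * s * g.2)%g in
  match j with inl s => inl (h s) | inr s => inr (h s) end.

Lemma ineq_actE j g d : ineq (ineq_act g j) (Defs.act d g) = ineq j d.
Proof.
case: j => s; rewrite /= ?/OT ?/NN !permM !act_entry; case: (g.1 == 0);
  rewrite ?perm1 ?tpermL ?tpermR ?tpermD //.
by rewrite [X in X - _]addrC.
Qed.

Lemma act_ineq_face g j : act_set (ineq_face j) g = ineq_face (ineq_act g j).
Proof.
apply/seteqP; split=> [_ [x [Cx jx0] <-]|x [Cx jx0]].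
  by split; [exact: QMET_act | rewrite ineq_actE].
exists (Defs.act x (g^-1)%g); last exact: act_byKV.
split; first exact: QMET_act.
rewrite -(ineq_actE j g) -[Defs.act _ g]/(act_by g (act_by (g^-1)%g x)).
by rewrite act_byKV.
Qed.

Lemma ineq_act1 s :
  (ineq_act (0, s) (inl 1%g) = inl s) /\ (ineq_act (0, s) (inr 1%g) = inr s).
Proof. by rewrite /ineq_act /= !mul1g. Qed.

Lemma OT_facesE : OT_faces R 3 = range (ineq_face \o inl).
Proof.
apply/seteqP; split=> [_ [i [j [k [/perm3P[s [<- <- <-]] ->]]]]|_ [s _ <-]].
  by exists s.
exists (s pt1), (s pt2), (s pt3); split=> //.
by rewrite (map_inj_uniq perm_inj [:: pt1; pt2; pt3]).
Qed.

Lemma NN_facesE : NN_faces R 3 = range (ineq_face \o inr).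
Proof.
apply/seteqP; split=> [_ [i [j [/perm2P[s [<- <-]] ->]]]|_ [s _ <-]].
  by exists s.
by exists (s pt1), (s pt2); rewrite (inj_eq perm_inj).
Qed.

Lemma orbit_OT_face s : orbit_set (ineq_face (inl s)) = OT_faces R 3.
Proof.
have [<- _] := ineq_act1 s; rewrite -act_ineq_face orbit_set_act OT_facesE.
apply/seteqP; split=> [_ [g _ <-]|_ [t _ <-]].
  by rewrite act_ineq_face; eexists.
by exists (0, t) => //; rewrite act_ineq_face; have [-> _] := ineq_act1 t.
Qed.

Lemma orbit_NN_face s : orbit_set (ineq_face (inr s)) = NN_faces R 3.
Proof.
have [_ <-] := ineq_act1 s; rewrite -act_ineq_face orbit_set_act NN_facesE.
apply/seteqP; split=> [_ [g _ <-]|_ [t _ <-]].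
  by rewrite act_ineq_face; eexists.
by exists (0, t) => //; rewrite act_ineq_face; have [_ ->] := ineq_act1 t.
Qed.

Lemma has_dim_act (F : set 'M[R]_3) k g : has_dim F k -> has_dim (act_set F g) k.
Proof.
exact: (has_dim_image (f := act_by g) (g := act_by (g^-1)%g) (@act_byK _ _ g)).
Qed.

End Orbits.

(** * The transportation problem behind the decomposition *)

Lemma exists_max3 (R : realDomainType) (a b c : R) :
  exists t, [/\ a <= t, b <= t, c <= t & [\/ t = a, t = b | t = c]].
Proof.
case: (leP a b) => ab; case: (leP b c) => bc; case: (leP a c) => ac.
all: try by exists c; split; first [lra | constructor 3].
all: try by exists b; split; first [lra | constructor 2].
all: try by exists a; split; first [lra | constructor 1].
Qed.

(* The entries of a 3-point quasi-metric are read as u = (d12, d23, d31) and   *)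
(* w = (d21, d32, d13): the triangle inequalities become u_k <= w_i + w_j and  *)
(* w_k <= u_i + u_j, the cuts are u_i + w_j for i != j, and the other          *)
(* multi-cuts are u_i + u_j + w_k and w_i + w_j + u_k.                         *)
Lemma balanced_transport (R : realFieldType) (u1 u2 u3 w1 w2 w3 : R) :
  0 <= u1 -> 0 <= u2 -> 0 <= u3 -> 0 <= w1 -> 0 <= w2 -> 0 <= w3 ->
  w1 <= u2 + u3 -> w2 <= u3 + u1 -> w3 <= u1 + u2 ->
  u1 + u2 + u3 = w1 + w2 + w3 ->
  exists t12 t13 t21 t23 t31 t32 : R,
    [/\ 0 <= t12 /\ 0 <= t13, 0 <= t21 /\ 0 <= t23 & 0 <= t31 /\ 0 <= t32] /\
    ([/\ u1 = t12 + t13, u2 = t21 + t23 & u3 = t31 + t32] /\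
     [/\ w1 = t21 + t31, w2 = t12 + t32 & w3 = t13 + t23]).
Proof.
(* The solutions of the equations form a line with parameter [x = t12]. The three terms are its
   lower bounds, from the signs of [t12], [t31] and [t23]; their maximum meets the upper bounds by
   the hypotheses. *)
move=> *; have [x [x1 x2 x3 xE]] := exists_max3 0 (w2 - u3) (u1 - w3).
exists x, (u1 - x), (u1 + u2 - w3 - x), (w3 - u1 + x), (u3 - w2 + x), (w2 - x).
by case: xE => xE; repeat split; lra.
Qed.

(** The [p_i >= 0] must sum to the excess [s] and satisfy [s - u_i <= p_i <= w_i]. Removing these
    multi-cuts balances the two sides, and the bound [w_i <= u_j + u_k] required of the remainder
    then reads [u_i <= w_j + w_k] in the original variables, whatever the choice. *)
Lemma excess_transport (R : realFieldType) (u1 u2 u3 w1 w2 w3 : R) :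
  0 <= u1 -> 0 <= u2 -> 0 <= u3 -> 0 <= w1 -> 0 <= w2 -> 0 <= w3 ->
  u1 <= w2 + w3 -> u2 <= w3 + w1 -> u3 <= w1 + w2 ->
  w1 <= u2 + u3 -> w2 <= u3 + u1 -> w3 <= u1 + u2 ->
  w1 + w2 + w3 <= u1 + u2 + u3 ->
  exists p1 p2 p3 t12 t13 t21 t23 t31 t32 : R,
    [/\ 0 <= p1, 0 <= p2 & 0 <= p3] /\
    [/\ 0 <= t12 /\ 0 <= t13, 0 <= t21 /\ 0 <= t23 & 0 <= t31 /\ 0 <= t32] /\
    ([/\ u1 = t12 + t13 + p2 + p3, u2 = t21 + t23 + p1 + p3
       & u3 = t31 + t32 + p1 + p2] /\
     [/\ w1 = t21 + t31 + p1, w2 = t12 + t32 + p2 & w3 = t13 + t23 + p3]).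
Proof.
move=> *; pose s := u1 + u2 + u3 - (w1 + w2 + w3).
(* Greedy choice: besides the bounds [0] and [s - u_i], [p1] must leave at most [w2 + w3] to the
   other two, and [p2] at most [w3] to [s - p1 - p2]. *)
have [p1 [p1a p1b p1c p1E]] := exists_max3 0 (s - u1) (s - w2 - w3).
have [p2 [p2a p2b p2c p2E]] := exists_max3 0 (s - u2) (s - p1 - w3).
rewrite /s in p1b p1c p1E p2b p2c p2E.
have [p1d p1e p1f p1g p1h] : [/\ p1 <= w1, p1 <= s, p1 + s <= u2 + u3,
    p1 <= u2 & p1 <= u3] by rewrite /s; case: p1E => p1E; split; lra.
have {p1E} [p2d p2e p2f] : [/\ p2 <= w2, p1 + p2 <= s & p1 + p2 <= u3].
  by rewrite /s in p1d p1e p1f p1g p1h *; case: p2E => p2E; split; lra.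
rewrite /s in p1e p1f p2e; clear p2E.
have [] := @balanced_transport R (u1 - s + p1) (u2 - s + p2) (u3 - p1 - p2)
  (w1 - p1) (w2 - p2) (w3 - (s - p1 - p2)).
1-10: by rewrite /s; lra.
move=> t12 [t13 [t21 [t23 [t31 [t32 [t_ge0 [[? ? ?] [? ? ?]]]]]]]].
exists p1, p2, (s - p1 - p2), t12, t13, t21, t23, t31, t32.
split; last by split=> //; rewrite /s in t_ge0 *; repeat split; lra.
by rewrite /s; split; lra.
Qed.

(** * Closure properties of conic hulls *)

Section ConeHull.
Variables (R : realType) (V : vectType R) (G : set V).

Lemma cone_hullZ c x : 0 <= c -> G x -> cone_hull G (c *: x).
Proof.
move=> c0 Gx; exists 1%N, (fun=> x), (fun=> c).
by split=> //; rewrite big_ord1.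
Qed.

Lemma cone_hullD x y : cone_hull G x -> cone_hull G y -> cone_hull G (x + y).
Proof.
case=> [k [g [c [Gg c0 ->]]]] [m [h [e [Gh e0 ->]]]].
exists (k + m)%N,
  (fun i => match fintype.split i with inl a => g a | inr b => h b end),
  (fun i => match fintype.split i with inl a => c a | inr b => e b end); split.
- by move=> i; case: fintype.split.
- by move=> i; case: fintype.split.
- rewrite big_split_ord /=; congr (_ + _); apply: eq_bigr => i _.
    by rewrite (unsplitK (inl i)).
  by rewrite (unsplitK (inr i)).
Qed.

Lemma cone_hull_image (f : {linear V -> V}) : (forall x, G x -> G (f x)) ->
  forall x, cone_hull G x -> cone_hull G (f x).
Proof.
move=> fG x [k [g [c [Gg c0 ->]]]]; exists k, (f \o g), c; split=> //.
  by move=> i; apply: fG.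
by rewrite linear_sum; apply: eq_bigr => i _; rewrite linearZ.
Qed.

End ConeHull.

(** * Equality of the two cones *)

Section Three.
Variable R : realType.

Definition mx6 (a12 a13 a21 a23 a31 a32 : R) : 'M[R]_3 :=
  \matrix_(i, j)
    (nth [::] [:: [:: 0; a12; a13]; [:: a21; 0; a23]; [:: a31; a32; 0]] i)`_j.

Lemma QMET_entries d : QMET R 3 d ->
  [/\ d = mx6 (d pt1 pt2) (d pt1 pt3) (d pt2 pt1)
              (d pt2 pt3) (d pt3 pt1) (d pt3 pt2),
      [/\ 0 <= d pt1 pt2, 0 <= d pt1 pt3 & 0 <= d pt2 pt1] /\
      [/\ 0 <= d pt2 pt3, 0 <= d pt3 pt1 & 0 <= d pt3 pt2],
      [/\ d pt1 pt2 <= d pt1 pt3 + d pt3 pt2, d pt1 pt3 <= d pt1 pt2 + d pt2 pt3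
        & d pt2 pt1 <= d pt2 pt3 + d pt3 pt1]
    & [/\ d pt2 pt3 <= d pt2 pt1 + d pt1 pt3, d pt3 pt1 <= d pt3 pt2 + d pt2 pt1
        & d pt3 pt2 <= d pt3 pt1 + d pt1 pt2]].
Proof.
case=> d0 dOT dNN; rewrite /OT in dOT; split.
- by apply/matrixP; do 2 elim/ord3P; rewrite mxE /= ?d0.
- by do ! split; apply: dNN.
- by split; rewrite -subr_ge0; apply: dOT.
- by split; rewrite -subr_ge0; apply: dOT.
Qed.

Lemma QMET_mx6 a12 a13 a21 a23 a31 a32 :
  0 <= a12 -> 0 <= a13 -> 0 <= a21 -> 0 <= a23 -> 0 <= a31 -> 0 <= a32 ->
  a12 <= a13 + a32 -> a13 <= a12 + a23 -> a21 <= a23 + a31 ->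
  a23 <= a21 + a13 -> a31 <= a32 + a21 -> a32 <= a31 + a12 ->
  QMET R 3 (mx6 a12 a13 a21 a23 a31 a32).
Proof.
move=> *; split.
- by elim/ord3P; rewrite mxE.
- by do 3 elim/ord3P=> //; move=> _; rewrite /OT !mxE /= subr_ge0.
- by do 2 elim/ord3P=> //; move=> _; rewrite /NN !mxE.
Qed.

Lemma gen_QMET x : QMET R 3 (gen R x).
Proof.
have g01 i j : gen R x i j = 0 \/ gen R x i j = 1.
  by case: x => [c|s]; rewrite mxE;
    [case: (if _ then _ else _) | case: (_ < _)%N]; [right|left|right|left].
split.
- by case: x {g01} => [[[] k]|s] i; rewrite /= mxE /= ?ltnn //; case: (i == k).
- move=> i j k _; rewrite /OT; case: x {g01} => [[b c]|s]; rewrite /= !mxE /=.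
    by case: b (i == c) (j == c) (k == c) => [] [] [] [] /=; lra.
  by case: (ltnP (s i) (s k)); case: (ltnP (s k) (s j));
    case: (ltnP (s i) (s j)) => /=; lia || lra.
- by move=> i j _; rewrite /NN; have [->|->] := g01 i j.
Qed.

Lemma perm3_ranks i j k : uniq [:: i; j; k] -> exists s : 'S_3,
  [/\ s i = pt1, s j = pt2 & s k = pt3].
Proof. by move=> /perm3P[s [<- <- <-]]; exists (s^-1)%g; rewrite !permK. Qed.

(** When the cycle 1, 2, 3 is at least as long as its reverse, the linear orders involved are the
    three rotations of 1, 2, 3, with ranks [s1], [s2], [s3]. *)
Lemma QMET_hull_excess d : QMET R 3 d ->
  d pt2 pt1 + d pt3 pt2 + d pt1 pt3 <= d pt1 pt2 + d pt2 pt3 + d pt3 pt1 ->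
  OMCUT R 3 d.
Proof.
move=> /QMET_entries[dE [[n1 n2 n3] [n4 n5 n6]] [o1 o2 o3] [o4 o5 o6]] le_wu.
have [] := @excess_transport R (d pt1 pt2) (d pt2 pt3) (d pt3 pt1)
                               (d pt2 pt1) (d pt3 pt2) (d pt1 pt3).
1-13: by lra.
move=> p1 [p2 [p3 [t12 [t13 [t21 [t23 [t31 [t32]]]]]]]].
move=> [[p1_ge0 p2_ge0 p3_ge0] [[[? ?] [? ?] [? ?]] [[u1 u2 u3] [w1 w2 w3]]]].
have [//|s1 [s12 s13 s11]] := @perm3_ranks pt2 pt3 pt1.
have [//|s2 [s23 s21 s22]] := @perm3_ranks pt3 pt1 pt2.
have [//|s3 [s31 s32 s33]] := @perm3_ranks pt1 pt2 pt3.
have hull c x : 0 <= c -> OMCUT R 3 (c *: gen R x).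
  by move=> c0; apply: cone_hullZ => //; rewrite omcutsE; exists x.
have -> : d =
    t12 *: gen R (inl (true, pt2)) + t13 *: gen R (inl (false, pt1)) +
    t21 *: gen R (inl (false, pt2)) + t23 *: gen R (inl (true, pt3)) +
    t31 *: gen R (inl (true, pt1)) + t32 *: gen R (inl (false, pt3)) +
    p1 *: gen R (inr s1) + p2 *: gen R (inr s2) + p3 *: gen R (inr s3).
  rewrite [LHS]dE; apply/matrixP; do 2 elim/ord3P;
    rewrite !mxE ?s11 ?s12 ?s13 ?s21 ?s22 ?s23 ?s31 ?s32 ?s33 /=;
    by rewrite ?u1 ?u2 ?u3 ?w1 ?w2 ?w3; lra.
by do ! apply: cone_hullD; apply: hull.
Qed.

Lemma omcuts_act d g : omcuts R 3 d -> omcuts R 3 (act_by g d).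
Proof.
rewrite omcutsE => -[[c|s] _ <-] /=; rewrite /act_by.
  by rewrite act_cut_mx; exists (inl (c.1 (+) (g.1 != 0), g.2 c.2)).
by rewrite act_mcut_mx; eexists (inr _).
Qed.

Lemma OMCUT_QMET : OMCUT R 3 = QMET R 3.
Proof.
apply/seteqP; split=> [_ [k [g [c [Gg c0 ->]]]]|d Cd].
  have Cg i : QMET R 3 (g i).
    by have := Gg i; rewrite omcutsE => -[x _ <-]; exact: gen_QMET.
  apply/QMET_ineq; split=> [i|j].
    rewrite summxE big1 // => m _; rewrite mxE.
    by have [-> _ _] := Cg m; rewrite mulr0.
  rewrite linear_sum sumr_ge0 // => i _; rewrite linearZ mulr_ge0 //.
  by have /QMET_ineq[_ Cgi] := Cg i; exact: Cgi.
have [le_wu|/ltW le_uw] := leP (d pt2 pt1 + d pt3 pt2 + d pt1 pt3)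
                               (d pt1 pt2 + d pt2 pt3 + d pt3 pt1).
  exact: QMET_hull_excess.
(* Reversal exchanges the two directed cycles and preserves both cones. *)
pose g : 'Z_2 * 'S_3 := (1, 1%g).
rewrite -(act_byKV g d); apply: cone_hull_image => [x|]; first exact: omcuts_act.
apply: QMET_hull_excess; first exact: QMET_act.
by rewrite /act_by !mxE /= !invg1 !perm1.
Qed.
End Three.

(** * Extreme rays *)

Section Faces.
Variable R : realType.

(** For each representative, the non-negativity terms of the functional force the entries that must
    be 0, and its two triangle terms equate the entries that must be 1. *)
Lemma ray_gen_face x : is_face (QMET R 3) (ray (gen R x)).
Proof.
case: x => [c|s].
  have : range (cut_mx R) (gen R (inl c)) by exists c.
  rewrite -orbit_cut_mx => -[g _ <-]; rewrite -act_set_ray; apply: is_face_act.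
  exists (NN pt2 pt1 \+ NN pt3 pt1 \+ NN pt2 pt3 \+ NN pt3 pt2
          \+ OT pt1 pt2 pt3 \+ OT pt1 pt3 pt2); split.
    by move=> d /QMET_entries[_ [[? ? ?] [? ? ?]] [? ? ?] [? ? ?]];
      rewrite /= /OT /NN; lra.
  apply/seteqP; split=> [_ [a /= a0 <-]|d [Cd]].
    split; last by rewrite /= /OT /NN !mxE /=; lra.
    rewrite (_ : a *: _ = mx6 a a 0 0 0 0); first by apply: QMET_mx6; lra.
    by apply/matrixP; do 2 elim/ord3P; rewrite !mxE /= ?mulr0 ?mulr1.
  case/QMET_entries: Cd => [dE [[? ? ?] [? ? ?]] [? ? ?] [? ? ?]].
  rewrite /= /OT /NN => f0; exists (d pt1 pt2) => //.
  by rewrite [RHS]dE; apply/matrixP; do 2 elim/ord3P; rewrite !mxE /=; lra.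
have : range (mcut_mx R) (gen R (inr s)) by exists s.
rewrite -orbit_mcut_mx => -[g _ <-]; rewrite -act_set_ray; apply: is_face_act.
exists (NN pt2 pt1 \+ NN pt3 pt1 \+ NN pt3 pt2
        \+ OT pt1 pt2 pt3 \+ OT pt2 pt3 pt1); split.
  by move=> d /QMET_entries[_ [[? ? ?] [? ? ?]] [? ? ?] [? ? ?]];
    rewrite /= /OT /NN; lra.
apply/seteqP; split=> [_ [a /= a0 <-]|d [Cd]].
  split; last by rewrite /= /OT /NN !mxE /= !perm1 /=; lra.
  rewrite (_ : a *: _ = mx6 a a 0 a 0 0); first by apply: QMET_mx6; lra.
  by apply/matrixP; do 2 elim/ord3P; rewrite !mxE /= ?perm1 /= ?mulr0 ?mulr1.
case/QMET_entries: Cd => [dE [[? ? ?] [? ? ?]] [? ? ?] [? ? ?]].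
rewrite /= /OT /NN => f0; exists (d pt1 pt2) => //.
by rewrite [RHS]dE; apply/matrixP; do 2 elim/ord3P; rewrite !mxE ?perm1 /=; lra.
Qed.

Lemma gen_entry1 x : exists i j, gen R x i j = 1.
Proof.
apply: contrapT => no1; apply: (@gen_nonzero R x); apply/matrixP=> i j.
rewrite [RHS]mxE; have : gen R x i j = 0 \/ gen R x i j = 1.
  case: x {no1} => [c|s]; rewrite /= mxE.
    by case: (if _ then _ else _); [right | left].
  by case: (_ < _)%N; [right | left].
by case=> // e1; case: no1; exists i, j.
Qed.

(** Every generator has largest entry 1, which fixes its scale on the ray. *)
Lemma ray_gen_inj : injective (fun x => ray (gen R x)).
Proof.
move=> x y eq_ray.
have rayx z : ray (gen R z) (gen R z) by exists 1; rewrite /= ?ler01 ?scale1r.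
have : ray (gen R y) (gen R x) by rewrite -eq_ray.
have : ray (gen R x) (gen R y) by rewrite eq_ray.
move=> [a a0 ay] [b b0 bx].
have le1 z i j : gen R z i j <= 1.
  case: z => [c|s]; rewrite /= mxE; first by case: (if _ then _ else _).
  by case: (_ < _)%N.
have [i [j x1]] := gen_entry1 x; have [k [l y1]] := gen_entry1 y.
have a1 : a <= 1 by move: (le1 y i j); rewrite -ay mxE x1 mulr1.
have b1 : 1 <= a.
  move: y1; rewrite -ay mxE => y1; rewrite -y1.
  by rewrite -[leRHS]mulr1 ler_wpM2l.
apply: (@gen_inj R); rewrite -ay (_ : a = 1) ?scale1r //.
by apply/eqP; rewrite eq_le a1.
Qed.

Lemma extreme_raysE :
  extreme_rays (QMET R 3) = range (fun x => ray (gen R x)).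
Proof.
apply/seteqP; split=> [F [[f [f_ge0 FE]] [X [freeX XF FX]]]|_ [x _ <-]]; last first.
  split; [exact: ray_gen_face | apply: has_dim_ray].
  by apply/eqP; exact: gen_nonzero.
case: X freeX XF FX => -[//|v [|//]] sX freeX XF FX.
rewrite /= span_seq1 in FX; rewrite /= seq1_free in freeX.
have Fv : F v by apply: XF; rewrite inE.
have [Cv fv0] : induced_face (QMET R 3) f v by rewrite -FE.
move: (Cv); rewrite -OMCUT_QMET => -[k [g [c [Gg c0 vE]]]].
have gP i : exists x, g i = gen R x.
  by have := Gg i; rewrite omcutsE => -[x _ <-]; exists x.
have fg_ge0 i : 0 <= f (g i).
  by have [x ->] := gP i; apply: f_ge0; exact: gen_QMET.
have [i ci] : exists i, c i != 0.
  apply: contrapT => all0; case/eqP: freeX; rewrite vE big1 // => i _.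
  have [-> | ci] := eqVneq (c i) 0; first by rewrite scale0r.
  by case: all0; exists i.
(* The terms [c m * f (g m)] are non-negative and sum to [f v = 0], so each of them vanishes. *)
have fgi : f (g i) = 0.
  have sum0 : \sum_i c i * f (g i) = 0.
    rewrite -[RHS]fv0 vE linear_sum; apply: eq_bigr => m _.
    by rewrite linearZ.
  have := psumr_eq0P _ sum0 => /(_ (fun m _ => mulr_ge0 (c0 m) (fg_ge0 m))).
  by move=> /(_ i isT)/eqP; rewrite mulf_eq0 (negPf ci) => /eqP.
have [x gx] := gP i; exists x => //.
have Fg : F (gen R x).
  by rewrite FE; split; [exact: gen_QMET | rewrite -gx].
have [a ga] : exists a, gen R x = a *: v by apply/vlineP; exact: FX.
have a0 : a != 0.
  by apply/eqP=> a0; apply: (@gen_nonzero R x); rewrite ga a0 scale0r.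
apply/seteqP; split=> [_ [b b0 <-]|y Fy].
  rewrite FE; split; last by rewrite linearZ /= -gx fgi mulr0.
  rewrite -OMCUT_QMET; apply: cone_hullZ => //.
  by rewrite omcutsE; exists x.
have [b yE] : exists b, y = b *: v by apply/vlineP; exact: FX.
have {}yE : y = (b / a) *: gen R x by rewrite ga scalerA divfK.
exists (b / a) => //=.
(* So far [y] is only known to lie on the line; an entry where the generator is 1 reveals the sign
   of the multiplier. *)
have [k1 [k2 x1]] := gen_entry1 x.
have : 0 <= y k1 k2.
  have [y0 _ yNN] : QMET R 3 y by move: Fy; rewrite FE => -[].
  by have [->|nk] := eqVneq k1 k2; [rewrite y0 | exact: yNN].
by rewrite yE mxE x1 mulr1.
Qed.

(** * Dimensions and facets *)

Lemma has_dim_QMET : has_dim (QMET R 3) 6.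
Proof.
exists [tuple mx6 (2 : R) 1 1 1 1 1; mx6 1 2 1 1 1 1; mx6 1 1 2 1 1 1;
  mx6 1 1 1 2 1 1; mx6 1 1 1 1 2 1; mx6 1 1 1 1 1 2]; split.
(* Indexing the coefficients by naturals makes the unrolled sum refer to numerals instead of
   iterated lifts. *)
- apply/freeP=> k; pose c m := k (inord m).
  have kE i : k i = c i by rewrite /c inord_val.
  under eq_bigr do rewrite kE; rewrite !big_ord_recl big_ord0 /= /bump /=.
  move=> /matrixP sum0.
  move: (sum0 pt1 pt2) (sum0 pt1 pt3) (sum0 pt2 pt1).
  move: (sum0 pt2 pt3) (sum0 pt3 pt1) (sum0 pt3 pt2).
  rewrite !mxE /= => e1 e2 e3 e4 e5 e6.
  by case=> -[|[|[|[|[|[|//]]]]]] lt_i; rewrite kE /=; lra.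
- by move=> x; rewrite !inE => /or4P[| | |/or3P[]] /eqP->; apply: QMET_mx6; lra.
- move=> d /QMET_entries[dE _ _ _].
  (* The basis is the all-ones matrix plus each unit vector, so [s] must be the sum of the
     coefficients. Adding up the six entry equations gives [(1 + 6) * s] as the sum of the entries
     of [d]. *)
  pose s := (d pt1 pt2 + d pt1 pt3 + d pt2 pt1 +
             d pt2 pt3 + d pt3 pt1 + d pt3 pt2) / 7.
  rewrite (_ : d = (d pt1 pt2 - s) *: mx6 2 1 1 1 1 1 +
    (d pt1 pt3 - s) *: mx6 1 2 1 1 1 1 + (d pt2 pt1 - s) *: mx6 1 1 2 1 1 1 +
    (d pt2 pt3 - s) *: mx6 1 1 1 2 1 1 + (d pt3 pt1 - s) *: mx6 1 1 1 1 2 1 +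
    (d pt3 pt2 - s) *: mx6 1 1 1 1 1 2); last first.
    by rewrite [LHS]dE; apply/matrixP; do 2 elim/ord3P; rewrite !mxE /s /=; lra.
  by do ! apply: rpredD; apply: rpredZ; apply: memv_span; rewrite !inE eqxx ?orbT.
Qed.

(* The basis consists of the unit perturbations, within the facet, of the      *)
(* relative interior point used in ineq_face_point.                            *)
Lemma has_dim_NN_face1 : has_dim (@ineq_face R (inr 1%g)) 5.
Proof.
exists [tuple mx6 (0 : R) 5 4 6 6 4; mx6 0 4 5 6 6 4; mx6 0 4 4 7 6 4;
  mx6 0 4 4 6 7 4; mx6 0 4 4 6 6 5]; split.
- apply/freeP=> k; pose c m := k (inord m).
  have kE i : k i = c i by rewrite /c inord_val.
  under eq_bigr do rewrite kE; rewrite !big_ord_recl big_ord0 /= /bump /=.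
  move=> /matrixP sum0; move: (sum0 pt1 pt3) (sum0 pt2 pt1).
  move: (sum0 pt2 pt3) (sum0 pt3 pt1) (sum0 pt3 pt2).
  rewrite !mxE /= => e1 e2 e3 e4 e5.
  by case=> -[|[|[|[|[|//]]]]] lt_i; rewrite kE /=; lra.
- move=> x; rewrite !inE => /or4P[| | |/orP[]] /eqP->; split;
    by [apply: QMET_mx6; lra | rewrite /= /NN !perm1 mxE].
- move=> d [/QMET_entries[dE _ _ _]]; rewrite /= /NN !perm1 => d0.
  (* The free entries of the base point sum to 24, whence the denominator 24 + 1. *)
  pose s := (d pt1 pt3 + d pt2 pt1 + d pt2 pt3 + d pt3 pt1 + d pt3 pt2) / 25.
  rewrite (_ : d = (d pt1 pt3 - 4 * s) *: mx6 0 5 4 6 6 4 +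
    (d pt2 pt1 - 4 * s) *: mx6 0 4 5 6 6 4 +
    (d pt2 pt3 - 6 * s) *: mx6 0 4 4 7 6 4 +
    (d pt3 pt1 - 6 * s) *: mx6 0 4 4 6 7 4 +
    (d pt3 pt2 - 4 * s) *: mx6 0 4 4 6 6 5); last first.
    rewrite [LHS]dE; apply/matrixP; do 2 elim/ord3P; rewrite !mxE /s /= ?d0; lra.
  by do ! apply: rpredD; apply: rpredZ; apply: memv_span; rewrite !inE eqxx ?orbT.
Qed.

(** On this face the entry (1,2) is the sum of the entries (1,3) and (3,2), so the other five serve
    as coordinates. The base point is [mx6 8 4 8 6 6 4], whose five coordinates sum to 28. *)
Lemma has_dim_OT_face1 : has_dim (@ineq_face R (inl 1%g)) 5.
Proof.
exists [tuple mx6 (9 : R) 5 8 6 6 4; mx6 8 4 9 6 6 4; mx6 8 4 8 7 6 4;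
  mx6 8 4 8 6 7 4; mx6 9 4 8 6 6 5]; split.
- apply/freeP=> k; pose c m := k (inord m).
  have kE i : k i = c i by rewrite /c inord_val.
  under eq_bigr do rewrite kE; rewrite !big_ord_recl big_ord0 /= /bump /=.
  move=> /matrixP sum0; move: (sum0 pt1 pt3) (sum0 pt2 pt1).
  move: (sum0 pt2 pt3) (sum0 pt3 pt1) (sum0 pt3 pt2).
  rewrite !mxE /= => e1 e2 e3 e4 e5.
  by case=> -[|[|[|[|[|//]]]]] lt_i; rewrite kE /=; lra.
- move=> x; rewrite !inE => /or4P[| | |/orP[]] /eqP->; split;
    by [apply: QMET_mx6; lra | rewrite /= /OT !perm1 !mxE /=; lra].
- move=> d [/QMET_entries[dE _ _ _]]; rewrite /= /OT !perm1 => d0.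
  pose s := (d pt1 pt3 + d pt2 pt1 + d pt2 pt3 + d pt3 pt1 + d pt3 pt2) / 29.
  rewrite (_ : d = (d pt1 pt3 - 4 * s) *: mx6 9 5 8 6 6 4 +
    (d pt2 pt1 - 8 * s) *: mx6 8 4 9 6 6 4 +
    (d pt2 pt3 - 6 * s) *: mx6 8 4 8 7 6 4 +
    (d pt3 pt1 - 6 * s) *: mx6 8 4 8 6 7 4 +
    (d pt3 pt2 - 4 * s) *: mx6 9 4 8 6 6 5); last first.
    rewrite [LHS]dE; apply/matrixP; do 2 elim/ord3P; rewrite !mxE /s /=; lra.
  by do ! apply: rpredD; apply: rpredZ; apply: memv_span; rewrite !inE eqxx ?orbT.
Qed.

Lemma has_dim_ineq_face j : has_dim (@ineq_face R j) 5.
Proof.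
case: j => s.
  have [<- _] := ineq_act1 s; rewrite -act_ineq_face.
  exact: has_dim_act has_dim_OT_face1.
have [_ <-] := ineq_act1 s; rewrite -act_ineq_face.
exact: has_dim_act has_dim_NN_face1.
Qed.

(** A relative interior point of each face separates it from the other eleven. Two explicit points
    suffice, the others being their images under the action. *)
Lemma ineq_face_point j : exists2 d, @ineq_face R j d &
  forall j', ineq R j' d = 0 -> j' = j.
Proof.
suff rep : forall j0, j0 = inl 1%g \/ j0 = inr 1%g ->
    exists2 d, @ineq_face R j0 d & forall j', ineq R j' d = 0 -> j' = j0.
  have move_rep s j0 : (exists2 d, @ineq_face R j0 d &
        forall j', ineq R j' d = 0 -> j' = j0) ->
      exists2 d, @ineq_face R (ineq_act (0, s) j0) d &
        forall j', ineq R j' d = 0 -> j' = ineq_act (0, s) j0.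
    case=> d Fd dP; exists (Defs.act d (0, s)).
      by rewrite -act_ineq_face; exists d.
    move=> j'; have {1}-> : j' = ineq_act (0, s) (ineq_act (0, s^-1)%g j').
      by case: j' => t; rewrite /ineq_act /= !mul1g mulgKV.
    rewrite ineq_actE => /dP <-.
    by case: j' => t; rewrite /ineq_act /= !mul1g mulgKV.
  case: j => s; have [e1 e2] := ineq_act1 s.
    by rewrite -e1; apply: move_rep; apply: rep; left.
  by rewrite -e2; apply: move_rep; apply: rep; right.
have key (s : 'S_3) : s pt1 = pt1 -> s pt2 = pt2 -> s = 1%g.
  by move=> s1 s2; apply: perm3_eq; rewrite ?s1 ?s2 perm1.
have uniqs (s : 'S_3) : uniq [:: s pt1; s pt2; s pt3].
  by rewrite (map_inj_uniq perm_inj [:: pt1; pt2; pt3]).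
move=> _ [->|->].
  exists (mx6 8 4 8 6 6 4).
    by split; [apply: QMET_mx6; lra | rewrite /= /OT !perm1 !mxE /=; lra].
  case=> s; rewrite /= ?/OT ?/NN; move: (uniqs s) (@key s).
    move: (s pt1) (s pt2) (s pt3); do 3 elim/ord3P=> //; rewrite !mxE /=;
      move=> _ K ?; first [by rewrite K | by exfalso; clear K; lra].
  move: (s pt1) (s pt2) (s pt3); do 3 elim/ord3P=> //; rewrite !mxE /=;
    by move=> _ K ?; exfalso; clear K; lra.
exists (mx6 0 4 4 6 6 4).
  by split; [apply: QMET_mx6; lra | rewrite /= /NN !perm1 !mxE].
case=> s; rewrite /= ?/OT ?/NN; move: (uniqs s) (@key s).
  move: (s pt1) (s pt2) (s pt3); do 3 elim/ord3P=> //; rewrite !mxE /=;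
    by move=> _ K ?; exfalso; clear K; lra.
move: (s pt1) (s pt2) (s pt3); do 3 elim/ord3P=> //; rewrite !mxE /=;
    move=> _ K ?; first [by rewrite K | by exfalso; clear K; lra].
Qed.

Lemma ineq_face_inj : injective (@ineq_face R).
Proof.
move=> j j' eqF; have [d Fd dP] := ineq_face_point j.
by move: (Fd); rewrite eqF => -[_ /dP].
Qed.

(* If no inequality vanishes on the whole face, the sum of points witnessing   *)
(* this is an interior point of the cone at which f vanishes, so f vanishes    *)
(* on the whole cone.                                                          *)
Lemma face_sub_ineq_face (f : {scalar 'M[R]_3}) : valid_on (QMET R 3) f ->
  (forall x, QMET R 3 x -> f x = 0) \/
  exists j, induced_face (QMET R 3) f `<=` @ineq_face R j.
Proof.
move=> f_ge0; case: (EM (exists j, induced_face (QMET R 3) f `<=` @ineq_face R j)).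
  by right.
move=> noj; left.
have ex j : exists x, induced_face (QMET R 3) f x /\ 0 < ineq R j x.
  apply: contrapT => nox; apply: noj; exists j => x Fx.
  have [Cx _] := Fx; split=> //; apply/eqP.
  have /QMET_ineq[_ /(_ j) jx] := Cx.
  rewrite eq_le jx andbT leNgt; apply/negP => jx_gt0.
  by apply: nox; exists x.
have [x xP] := choice ex; pose p := \sum_j x j.
have Cx j : QMET R 3 (x j) by have [[]] := xP j.
have ge0 j j' : 0 <= ineq R j' (x j) by have /QMET_ineq[_] := Cx j; apply.
have p_gt0 j : 0 < ineq R j p.
  rewrite linear_sum (bigD1 j) //=; apply: ltr_pwDl; first by have [] := xP j.
  by apply: sumr_ge0 => i _; exact: ge0.
have fp : f p = 0.
  by rewrite linear_sum big1 // => j _; have [[]] := xP j.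
move=> y Cy; have /QMET_ineq[y0 jy] := Cy.
(* [s] dominates every ratio, so [s *: p - y] stays in the cone; as [f p = 0], its value under [f]
   is [- f y], which forces [f y <= 0]. *)
pose s := 1 + \sum_j ineq R j y / ineq R j p.
have s_gt0 : 0 < s.
  apply: ltr_pwDl => //; apply: sumr_ge0 => j _.
  by rewrite divr_ge0 // ltW.
have Cz : QMET R 3 (s *: p - y).
  apply/QMET_ineq; split=> [i|j].
    rewrite !mxE y0 subr0 summxE big1 ?mulr0 // => j _.
    by have [-> _ _] := Cx j.
  rewrite linearB linearZ /= subr_ge0 -ler_pdivrMr //.
  rewrite /s (bigD1 j) //= addrCA lerDl addr_ge0 // sumr_ge0 // => i _.
  by rewrite divr_ge0 // ltW.
have := f_ge0 _ Cz; rewrite linearB linearZ /= fp mulr0 sub0r oppr_ge0 => fy.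
by apply/eqP; rewrite eq_le fy f_ge0.
Qed.

Lemma facetsE : facets (QMET R 3) = range (@ineq_face R).
Proof.
apply/seteqP; split=> [F [[f [f_ge0 FE]] [k [dC dF]]]|_ [j _ <-]]; last first.
  split; last by exists 5; split; [exact: has_dim_QMET | exact: has_dim_ineq_face].
  by exists (ineq R j); split=> // x /QMET_ineq[].
have [k5] := has_dim_inj dC has_dim_QMET; rewrite {k dC}k5 in dF.
have [f0|[j Fj]] := face_sub_ineq_face f_ge0.
  have FC : F = QMET R 3.
    by rewrite FE; apply/seteqP; split=> [x []|x Cx] //; split=> //; exact: f0.
  by rewrite FC in dF; have := has_dim_inj dF has_dim_QMET.
exists j => //; apply/seteqP; split; last by rewrite FE.
move=> x jx; have [Cx _] := jx; rewrite FE; split=> //.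
(* Both faces have dimension 5, hence the same span; the kernel of [f] contains [F], so it contains
   the whole face of [j]. *)
have FW y : F y -> y \in lker (linfun (f : 'M[R]_3 -> R^o)).
  by rewrite FE => -[_ fy]; rewrite memv_ker lfunE /= fy.
rewrite -FE in Fj.
have := has_dim_sub_span dF (has_dim_ineq_face j) Fj FW jx.
by rewrite memv_ker lfunE /= => /eqP.
Qed.
End Faces.

Theorem mainTheorem1 (R : realType) :
  [/\ OMCUT R 3 = QMET R 3,
      (* extreme rays *)
      [/\ omcuts R 3 #= `I_12,
          extreme_rays (QMET R 3) #= `I_12
        & extreme_rays (QMET R 3) = [set ray d | d in omcuts R 3]],
      (* orbits of extreme rays *)
      ([/\ ocuts R 3 #= `I_6,
           orbit_vec (omcut R cut_1_23) = ocuts R 3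
         & orbit_set (ray (omcut R cut_1_23)) = [set ray d | d in ocuts R 3]] /\
       [/\ (omcuts R 3 `\` ocuts R 3) #= `I_6,
           orbit_vec (omcut R mcut_1_2_3) = omcuts R 3 `\` ocuts R 3
         & orbit_set (ray (omcut R mcut_1_2_3)) =
             [set ray d | d in omcuts R 3 `\` ocuts R 3]]) /\
      (orbits (extreme_rays (QMET R 3)) #= `I_2 /\
       orbits (extreme_rays (QMET R 3)) =
         [set orbit_set (ray (omcut R cut_1_23));
              orbit_set (ray (omcut R mcut_1_2_3))]),
      (* facets *)
      [/\ facets (QMET R 3) #= `I_12,
          OT_faces R 3 #= `I_6,
          NN_faces R 3 #= `I_6
        & facets (QMET R 3) = OT_faces R 3 `|` NN_faces R 3]
    & (* orbits of facets *)
      orbits (facets (QMET R 3)) #= `I_2 /\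
      orbits (facets (QMET R 3)) = [set OT_faces R 3; NN_faces R 3]].
Proof.
have card_gen : #|{: bool * 'I_3 + 'S_3}| = 12%N.
  by rewrite card_sum card_prod card_bool card_ord card_Sn.
have card_cut : #|{: bool * 'I_3}| = 6%N by rewrite card_prod card_bool card_ord.
have card_S3 : #|{: 'S_3}| = 6%N by rewrite card_Sn.
have card_ineq : #|{: 'S_3 + 'S_3}| = 12%N by rewrite card_sum card_S3.
have cut_inj : injective (gen R \o inl) by move=> c c' /gen_inj[].
have mcut_inj : injective (gen R \o inr) by move=> s s' /gen_inj[].
have mcutsE : omcuts R 3 `\` ocuts R 3 = range (mcut_mx R).
  by rewrite omcutsE ocutsE; exact: (range_sumD (@gen_inj R)).
have raysE : extreme_rays (QMET R 3) = [set ray d | d in omcuts R 3].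
  by rewrite extreme_raysE omcutsE -image_comp.
have orbit_cut : orbit_set (ray (omcut R cut_1_23)) = [set ray d | d in ocuts R 3].
  by rewrite omcut_cut_1_23 orbit_set_ray orbit_cut_mx ocutsE.
have orbit_mcut : orbit_set (ray (omcut R mcut_1_2_3)) =
    [set ray d | d in omcuts R 3 `\` ocuts R 3].
  by rewrite omcut_mcut_1_2_3 orbit_set_ray orbit_mcut_mx mcutsE.
have orbit_ray x : orbit_set (ray (gen R x)) =
    orbit_set (ray (if x is inl _ then omcut R cut_1_23 else omcut R mcut_1_2_3)).
  case: x => [c|s].
    have : range (cut_mx R) (gen R (inl c)) by exists c.
    by rewrite -orbit_cut_mx omcut_cut_1_23 => -[g _ <-];
      rewrite -act_set_ray orbit_set_act.
  have : range (mcut_mx R) (gen R (inr s)) by exists s.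
  by rewrite -orbit_mcut_mx omcut_mcut_1_2_3 => -[g _ <-];
    rewrite -act_set_ray orbit_set_act.
split.
- exact: OMCUT_QMET.
- split=> //.
  + by rewrite omcutsE -card_gen; apply/card_eq_range/gen_inj.
  + by rewrite extreme_raysE -card_gen; apply/card_eq_range/ray_gen_inj.
- split; [split; split=> // | ].
  + by rewrite ocutsE -card_cut; apply: card_eq_range.
  + by rewrite omcut_cut_1_23 orbit_cut_mx ocutsE.
  + by rewrite mcutsE -card_S3; apply: card_eq_range.
  + by rewrite omcut_mcut_1_2_3 orbit_mcut_mx mcutsE.
  + have orbE : orbits (extreme_rays (QMET R 3)) =
        [set orbit_set (ray (omcut R cut_1_23));
             orbit_set (ray (omcut R mcut_1_2_3))].
      rewrite extreme_raysE; apply/seteqP; split=> [_ [_ [x _ <-] <-]|_ [] ->].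
      * by rewrite orbit_ray; case: x => [c|s]; [left | right].
      * exists (ray (gen R (inl (false, pt1)))); last exact: orbit_ray.
        by exists (inl (false, pt1)).
      * exists (ray (gen R (inr 1%g))); last exact: orbit_ray.
        by exists (inr 1%g).
    split=> //; rewrite orbE; apply: card_eq_set2.
    (* Were the orbits equal, the ray of a cut would also be the ray of a linear order. *)
    rewrite orbit_cut orbit_mcut mcutsE ocutsE => eq_orb.
    have : [set ray d | d in range (mcut_mx R)] (ray (gen R (inl (false, pt1)))).
      by rewrite -eq_orb; exists (cut_mx R (false, pt1)) => //; exists (false, pt1).
    by case=> _ [s _ <-] /(@ray_gen_inj R (inr s)).
- rewrite facetsE OT_facesE NN_facesE; split.
  + by rewrite -card_ineq; apply/card_eq_range/ineq_face_inj.
  + by rewrite -card_S3; apply: card_eq_range => s t /ineq_face_inj[].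
  + by rewrite -card_S3; apply: card_eq_range => s t /ineq_face_inj[].
  + exact: range_sum.
- have orbE : orbits (facets (QMET R 3)) = [set OT_faces R 3; NN_faces R 3].
    rewrite facetsE; apply/seteqP; split=> [_ [_ [[s|s] _ <-] <-]|_ [] ->].
    + by left; exact: orbit_OT_face.
    + by right; exact: orbit_NN_face.
    + by exists (ineq_face (inl 1%g)); [exists (inl 1%g) | exact: orbit_OT_face].
    + by exists (ineq_face (inr 1%g)); [exists (inr 1%g) | exact: orbit_NN_face].
  split=> //; rewrite orbE; apply: card_eq_set2.
  rewrite OT_facesE NN_facesE => eqF.
  have : range (@ineq_face R \o inr) (ineq_face (inl 1%g)).
    by rewrite -eqF; exists 1%g.
  by case=> s _ /ineq_face_inj.
Qed.
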